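(* There is a family $\mathcal{H}_2$ of $2^{\mathfrak{c}}$ many pairwise non-isomorphic Boolean subalgebras of $\wp(\omega)$, none of which is an analytic subset of $2^\omega$, such that each algebra in $\mathcal{H}_2$ has the Nikodym property but not the Grothendieck property.
   Context: $\mathfrak{c}$ denotes the cardinality of the continuum. Subsets of $\omega$ are identified with points of the Cantor space $2^\omega$ via characteristic functions, so Boolean subalgebras of $\wp(\omega)$ are subsets of $2^\omega$ and can be analytic or not. For a Boolean algebra $\mathcal{A}$, a measure on $\mathcal{A}$ is a finitely additive $\mu\colon\mathcal{A}\to\mathbb{R}$ with finite variation norm $\|\mu\|=\sup\{|\mu(A)|+|\mu(B)|\colon A,B\in\mathcal{A},\ A\wedge B=0\}$; $\mathrm{ba}(\mathcal{A})$ is the Banach space of such measures. $\mathcal{A}$ has the Nikodym property if every sequence $(\mu_n)$ in $\mathrm{ba}(\mathcal{A})$ with $\lim_n\mu_n(A)=0$ for all $A\in\mathcal{A}$ is norm bounded; it has the Grothendieck property if every norm bounded such sequence converges to $0$ weakly in $\mathrm{ba}(\mathcal{A})$. *)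

(* Defs.v *)
From HB Require Import structures.
From mathcomp Require Import all_boot all_order all_algebra.
From mathcomp Require Import all_classical all_reals all_analysis.
Set Implicit Arguments.
Unset Strict Implicit.
Unset Printing Implicit Defensive.
Import Order.TTheory GRing.Theory Num.Theory.
Import numFieldNormedType.Exports.
Local Open Scope classical_set_scope.
Local Open Scope ring_scope.

(* Boolean algebras are represented by [ctbDistrLatticeType]. *)

Section ba.
Context (R : realType) (d : Order.disp_t) (B : ctbDistrLatticeType d).

Definition finitely_additive (mu : B -> R^o) :=
  forall a b : B, (a `&` b = \bot)%O -> mu (a `|` b)%O = mu a + mu b.

Definition variation_set (mu : B -> R^o) : set R :=
  [set x | exists a b : B, (a `&` b = \bot)%O /\ x = `|mu a| + `|mu b|].

Definition is_ba : {pred B -> R^o} :=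
  [pred mu | `[< finitely_additive mu /\ has_ubound (variation_set mu) >]].

Record ba := Ba { ba_fun :> B -> R^o; _ : ba_fun \in is_ba }.

HB.instance Definition _ := [isSub for ba_fun].
HB.instance Definition _ := [Choice of ba by <:].

Lemma is_ba_submod_closed : submod_closed is_ba.
Proof.
split.
  apply/asboolP; split=> [a b _|]; first by rewrite addr0.
  by exists 0 => _ [a [b [_ ->]]]; rewrite normr0 addr0.
move=> k mu nu /asboolP[amu [M hM]] /asboolP[anu [N hN]].
apply/asboolP; split=> [a b ab|].
  by rewrite !fctE (amu _ _ ab) (anu _ _ ab) scalerDr addrACA.
exists (`|k| * M + N) => _ [a [b [ab ->]]]; rewrite !fctE.
apply: (@le_trans _ _ (`|k| * (`|mu a| + `|mu b|) + (`|nu a| + `|nu b|))).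
  rewrite mulrDr addrACA -!normrM.
  by apply: lerD; exact: ler_normD.
apply: lerD; last by apply: hN; exists a, b.
by rewrite ler_wpM2l//; apply: hM; exists a, b.
Qed.

HB.instance Definition _ :=
  GRing.isSubmodClosed.Build R (B -> R^o) is_ba is_ba_submod_closed.
HB.instance Definition _ := [SubChoice_isSubLmodule of ba by <:].

(* [sup] is real-valued; it is meaningful here because the variation of an
   element of [ba] is bounded by definition. *)
Definition ba_norm (mu : ba) : R := sup (variation_set mu).

Lemma variation_set_has_sup (mu : ba) : has_sup (variation_set mu).
Proof.
have /asboolP[_ ?] := valP mu; split => //.
by exists (`|mu \bot%O| + `|mu \bot%O|), \bot%O, \bot%O; rewrite meetx0.
Qed.

Lemma ba_norm_ub (mu : ba) (a b : B) :
  (a `&` b = \bot)%O -> `|mu a| + `|mu b| <= ba_norm mu.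
Proof.
move=> ab; apply: sup_upper_bound; last by exists a, b.
exact: variation_set_has_sup.
Qed.

Lemma ba_norm_lub (mu : ba) (M : R) :
  (forall a b : B, (a `&` b = \bot)%O -> `|mu a| + `|mu b| <= M) ->
  ba_norm mu <= M.
Proof.
move=> h; apply: sup_le_ub; first exact: (variation_set_has_sup mu).1.
by move=> _ [a [b [ab ->]]]; exact: h.
Qed.

Lemma ba_normD (mu nu : ba) :
  ba_norm (mu + nu) <= ba_norm mu + ba_norm nu.
Proof.
apply: ba_norm_lub => a b ab.
apply: (le_trans _ (lerD (ba_norm_ub mu ab) (ba_norm_ub nu ab))).
by rewrite addrACA; apply: lerD; exact: ler_normD.
Qed.

Lemma ba_normZ_le (k : R) (mu : ba) :
  ba_norm (k *: mu) <= `|k| * ba_norm mu.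
Proof.
apply: ba_norm_lub => a b ab.
have -> : `|(k *: mu : ba) a| + `|(k *: mu : ba) b| =
  `|k| * (`|mu a| + `|mu b|) by rewrite mulrDr -!normrM.
by rewrite ler_wpM2l// ba_norm_ub.
Qed.

Lemma ba_normZ (k : R) (mu : ba) : ba_norm (k *: mu) = `|k| * ba_norm mu.
Proof.
apply/eqP; rewrite eq_le ba_normZ_le /=.
have [->|k0] := eqVneq k 0.
  rewrite normr0 mul0r; apply: le_trans (ba_norm_ub _ (meetx0 \bot%O)).
  by rewrite addr_ge0.
rewrite -ler_pdivlMl ?normr_gt0// -normfV.
by have := ba_normZ_le k^-1 (k *: mu); rewrite scalerA mulVf// scale1r.
Qed.

Lemma ba_norm0_eq0 (mu : ba) : ba_norm mu = 0 -> mu = 0.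
Proof.
move=> mu0; apply: val_inj; apply/funext => a; apply/eqP.
rewrite -normr_le0 -mu0.
by apply: (le_trans _ (ba_norm_ub mu (meetx0 a))); rewrite lerDl.
Qed.

HB.instance Definition _ :=
  Lmodule_isNormed.Build R ba ba_normD ba_normZ ba_norm0_eq0.

End ba.

Definition weakly_null (R : realType) (V : normedModType R) (x : nat -> V) :=
  forall phi : {linear V -> R^o}, continuous phi ->
    phi (x n) @[n --> \oo] --> (0 : R^o).

Section nikodym_grothendieck.
Context (R : realType) (d : Order.disp_t) (B : ctbDistrLatticeType d).

Definition pointwise_null (mu : nat -> ba R B) :=
  forall a : B, mu n a @[n --> \oo] --> (0 : R^o).

Definition nikodym :=
  forall mu : nat -> ba R B, pointwise_null mu -> bounded_fun mu.

Definition grothendieck :=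
  forall mu : nat -> ba R B, bounded_fun mu -> pointwise_null mu ->
    weakly_null mu.

End nikodym_grothendieck.
Arguments nikodym R {d} B.
Arguments grothendieck R {d} B.

Definition boolean_isomorphic (d1 d2 : Order.disp_t)
    (B1 : ctbDistrLatticeType d1) (B2 : ctbDistrLatticeType d2) :=
  exists f : B1 -> B2,
    [/\ bijective f,
        {morph f : a b / (a `&` b)%O},
        {morph f : a b / (a `|` b)%O} &
        {morph f : a / (~` a)%O}].

Record subalgebra := Subalgebra {
  subalgebra_set :> set (set nat) ;
  subalgebra0 : subalgebra_set set0 ;
  subalgebraC : forall X, subalgebra_set X -> subalgebra_set (~` X) ;
  subalgebraU : forall X Y, subalgebra_set X -> subalgebra_set Y ->
    subalgebra_set (X `|` Y) }.

Lemma subalgebra_set_inj : injective subalgebra_set.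
Proof.
move=> [A A0 AC AU] [B B0 BC BU] /= AB; subst B.
by congr Subalgebra; exact: Prop_irrelevance.
Qed.

Section subalgebra_type.
Variable A : subalgebra.

Definition subalgebra_pred : {pred set nat} :=
  [pred X | `[< subalgebra_set A X >]].

Record subalgebra_type :=
  SubalgebraType { subalgebra_val :> set nat ;
    _ : subalgebra_val \in subalgebra_pred }.

HB.instance Definition _ := [isSub for subalgebra_val].
HB.instance Definition _ := [Choice of subalgebra_type by <:].

Lemma subalgebra_meet_closed :
  Order.ClosedPredicates.meet_closed subalgebra_pred.
Proof.
move=> X Y /asboolP AX /asboolP AY; apply/asboolP.
rewrite /Order.meet/= -[X `&` Y]setCK setCI.
by apply: subalgebraC; apply: subalgebraU; exact: subalgebraC.
Qed.

Lemma subalgebra_join_closed :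
  Order.ClosedPredicates.join_closed subalgebra_pred.
Proof. by move=> X Y /asboolP ? /asboolP ?; apply/asboolP/subalgebraU. Qed.

Lemma subalgebra_bot : \bot%O \in subalgebra_pred.
Proof. exact/asboolP/subalgebra0. Qed.

Lemma subalgebra_top : \top%O \in subalgebra_pred.
Proof.
apply/asboolP; rewrite /Order.top/= -setC0.
exact/subalgebraC/subalgebra0.
Qed.

HB.instance Definition _ := Order.SubChoice_isTBSubLattice.Build
  set_display (set nat) subalgebra_pred set_display subalgebra_type
  subalgebra_meet_closed subalgebra_join_closed subalgebra_bot subalgebra_top.

Lemma subalgebra_meetUl :
  left_distributive (@Order.meet _ subalgebra_type)
    (@Order.join _ subalgebra_type).
Proof.
by move=> X Y Z; apply: val_inj;
  rewrite !(Order.valI_subproof, Order.valU_subproof) meetUl.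
Qed.

HB.instance Definition _ := Order.Lattice_Meet_isDistrLattice.Build
  set_display subalgebra_type subalgebra_meetUl.

Fact subalgebra_compl_subproof (X : subalgebra_type) :
  ~` (X : set nat) \in subalgebra_pred.
Proof. by apply/asboolP/subalgebraC; exact: (asboolW (valP X)). Qed.

Definition subalgebra_compl (X : subalgebra_type) : subalgebra_type :=
  SubalgebraType (subalgebra_compl_subproof X).

Lemma subalgebra_joinxC X : (X `|` subalgebra_compl X = \top)%O.
Proof.
by apply: val_inj; rewrite Order.valU_subproof Order.val1_subproof; exact: setUCr.
Qed.

Lemma subalgebra_meetxC X : (X `&` subalgebra_compl X = \bot)%O.
Proof.
by apply: val_inj; rewrite Order.valI_subproof Order.val0_subproof; exact: setICr.
Qed.

HB.instance Definition _ := Order.TBDistrLattice_hasComplement.Build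
  set_display subalgebra_type subalgebra_joinxC subalgebra_meetxC.

End subalgebra_type.

Definition baire_space := prod_topology (fun _ : nat => nat).
HB.instance Definition _ := Topological.on baire_space.

(* As usual in descriptive set theory, the empty set is analytic, and it is not
   an image of the (inhabited) Baire space. *)
Definition analytic (X : topologicalType) (S : set X) :=
  S = set0 \/ exists2 f : baire_space -> X, continuous f & range f = S.

Definition char_fun (X : set nat) : cantor_space := fun n => `[< X n >].

(* Main.v *)
Require Import Defs.
From HB Require Import structures.
From mathcomp Require Import all_boot all_order all_algebra.
From mathcomp Require Import all_classical all_reals all_analysis.
From mathcomp Require Import unstable.
From mathcomp Require Import zify ring lra.
Set Implicit Arguments.
Unset Strict Implicit.
Unset Printing Implicit Defensive.
Import Order.TTheory Order.CTheory GRing.Theory Num.Theory.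
Import numFieldNormedType.Exports.
Local Open Scope classical_set_scope.
Local Open Scope ring_scope.
Local Open Scope card_scope.

(** Cut [nat] into the blocks [[2 ^ m, 2 ^ m.+1)] and attach to every branch [x]
    of the binary tree a set of blocks, almost disjoint for distinct branches.
    For a set [S] of branches, let [J] be the ideal of the sets whose density in
    the blocks of [x] tends to 0 for each [x] in [S], and let [A] be the algebra
    of the sets that are in [J] or whose complement is in [J].

    - [A] is not Grothendieck: the measures [2 ^- m * \sum_k (-1) ^+ k * \d_k]
      over the blocks [m] of some [x] in [S] tend to 0 on [A], but their mass on
      the even numbers is 1/2.
    - [A] is Nikodym: if a pointwise null sequence were unbounded on [J], one
      could split sets of [J] into residue classes modulo [2 ^ k] to obtain
      disjoint sets [F k] of [J], of density at most [2 ^- k] in every block,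
      on which some measure of the sequence exceeds [k]. All the unions of
      [F k]'s lie in [J], so the sequence induces measures on the power set of
      [nat], where a gliding hump gives a contradiction.
    - Distinct [S] give distinct [A]. An isomorphism is induced by a map on the
      atoms, and a continuous function on the Baire space is determined on a
      countable dense set; hence there are at most continuum many algebras in an
      isomorphism class, and at most continuum many analytic ones. A diagonal
      argument in the style of Koenig then leaves [2 ^ c] isomorphism classes of
      non-analytic algebras. *)

(** * Gliding hump on the power set of [nat] *)

Definition increasing (f : nat -> nat) := {homo f : i j / (i < j)%N}.

Lemma increasing_ge (f : nat -> nat) i : increasing f -> (i <= f i)%N.
Proof.
by move=> f_inc; elim: i => // i ih; apply: leq_ltn_trans ih _; exact: f_inc.
Qed.

Lemma increasing_inj (f : nat -> nat) : increasing f -> injective f.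
Proof.
by move=> f_inc i j fij; case: (ltngtP i j) => // /f_inc; rewrite fij ltnn.
Qed.

Lemma dependent_sequence (T : Type) (P : T -> Prop) (Q : T -> T -> Prop) x0 :
  P x0 -> (forall x, P x -> exists2 y, P y & Q x y) ->
  exists2 f : nat -> T, f 0%N = x0 &
    forall n, P (f n) /\ Q (f n) (f n.+1).
Proof.
move=> Px0 PQ.
have /choice[s sP] : forall x, exists y, P x -> P y /\ Q x y.
  move=> x; have [/PQ[y Py Qxy]|nPx] := pselect (P x); first by exists y.
  by exists x.
have Pf n : P (iter n s x0) by elim: n => // n /sP[].
by exists (fun n => iter n s x0) => // n; split => //; case: (sP _ (Pf n)).
Qed.

Lemma increasingS (f : nat -> nat) : (forall i, f i < f i.+1)%N -> increasing f.
Proof.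
move=> fS i; elim=> // j ih; rewrite ltnS leq_eqVlt => /orP[/eqP -> //|/ih].
by move=> /ltn_trans; apply.
Qed.

Lemma increasing_leq (f : nat -> nat) : increasing f ->
  {homo f : i j / (i <= j)%N}.
Proof.
by move=> f_inc i j; rewrite leq_eqVlt => /orP[/eqP -> //|/f_inc/ltnW].
Qed.

Section thinning.
Context {R : realType}.

Definition additive_on (T : Type) (J : set (set T)) (nu : set T -> R) :=
  forall X Y, J X -> J Y -> X `&` Y = set0 -> nu (X `|` Y) = nu X + nu Y.

Definition dominated_on (T : Type) (J : set (set T)) (nu : set T -> R) (B : R) :=
  forall X, J X -> `|nu X| <= B.

Lemma additive_on_opp (T : Type) (J : set (set T)) (nu : set T -> R) :
  additive_on J nu -> additive_on J (fun X => - nu X).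
Proof. by move=> nuD X Y JX JY XY; rewrite nuD// opprD. Qed.

(** Otherwise every subsequence of [f] carries a set of measure above 1; splitting repeatedly into
    even and odd positions yields disjoint such sets, whose union has measure beyond [B]. *)
Lemma thin_ub (nu : set nat -> R) (B : R) (f : nat -> nat) :
  additive_on setT nu -> dominated_on setT nu B -> increasing f ->
  exists2 g, increasing g &
    forall L, L `<=` range (f \o g) -> nu L <= 1.
Proof.
move=> nuD nuB f_inc; apply: contrapT => noG.
have big : forall i h, increasing h ->
    exists2 L, L `<=` range (f \o h) & i%:R <= nu L.
  elim=> [|i ih] h h_inc.
    exists set0 => //.
    have := nuD set0 set0 I I (setI0 _); rewrite setU0 => /eqP.
    by rewrite -subr_eq subrr => /eqP <-.
  have [|L1 L1h nuL1] := ih (h \o double).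
    by move=> a b ab /=; apply: h_inc; rewrite ltn_double.
  have [L2 L2h nuL2] : exists2 L, L `<=` range (f \o (h \o (fun i => i.*2.+1)))
      & 1 <= nu L.
    apply: contrapT => noL; apply: noG; exists (h \o (fun i => i.*2.+1)).
      by move=> a b ab /=; apply: h_inc; rewrite ltnS ltn_double.
    move=> L Lh; rewrite leNgt; apply/negP => nuL; apply: noL.
    by exists L => //; exact: ltW.
  exists (L1 `|` L2).
    move=> k [/L1h|/L2h] [j _ <-] /=; [by exists j.*2|by exists j.*2.+1].
  rewrite nuD//.
    by rewrite -natr1 lerD.
  apply/seteqP; split => // k [/L1h[a _ <-] /L2h[b _]] /= /eqP.
  move=> /eqP/(increasing_inj f_inc)/(increasing_inj h_inc)/(congr1 odd).
  by rewrite /= !odd_double.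
have [//|L _ nuL] := big (Num.bound B) id.
have := le_trans nuL (le_trans (ler_norm _) (nuB L I)).
by apply/negP; rewrite -ltNge; exact: ltr_bound.
Qed.

Lemma thin (nu : set nat -> R) (B : R) (f : nat -> nat) :
  additive_on setT nu -> dominated_on setT nu B -> increasing f ->
  exists2 g, increasing g &
    forall L, L `<=` range (f \o g) -> `|nu L| <= 1.
Proof.
move=> nuD nuB f_inc.
have [g g_inc gP] := thin_ub nuD nuB f_inc.
have [|||h h_inc hP] := @thin_ub (fun X => - nu X) B (f \o g).
- exact: additive_on_opp.
- by move=> X _; rewrite normrN; exact: nuB.
- by move=> i j ij; apply/f_inc/g_inc.
exists (g \o h); first by move=> i j ij; apply/g_inc/h_inc.
move=> L LP; rewrite ler_norml lerNl hP//= gP//.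
by move=> k /LP[i _ <-]; exists (h i).
Qed.

(** By induction on [N]: the bounds at the atoms add up, uniformly in [k]. *)
Lemma finite_dominated (nu : nat -> set nat -> R) :
  (forall k, additive_on setT (nu k)) ->
  (forall L, exists c, forall k, `|nu k L| <= c) ->
  forall N, exists c, forall k, dominated_on [set L | L `<=` `I_N] (nu k) c.
Proof.
move=> nuD nuB; elim=> [|N [c cP]].
  have [c cP] := nuB set0; exists c => k X /=.
  by rewrite II0 subset0 => ->.
have [c1 c1P] := nuB [set N]; have [c0 c0P] := nuB set0.
exists (c + (c1 + c0)) => k X /= XN.
have -> : X = (X `&` `I_N) `|` (X `&` [set N]).
  rewrite -setIUr; apply/seteqP; split => [i Xi|i []//]; split => //.
  by have := XN i Xi; rewrite /= ltnS leq_eqVlt => /orP[/eqP|]; [right|left].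
have c00 : 0 <= c0 by apply: le_trans (c0P 0%N).
have c10 : 0 <= c1 by apply: le_trans (c1P 0%N).
rewrite nuD//.
  apply: le_trans (ler_normD _ _) _; apply: lerD; first by apply: cP => i [].
  have [XNN|XNN] := pselect (X N).
    have -> : X `&` [set N] = [set N].
      by apply/seteqP; split => i; [case|move=> ->; split].
    by rewrite (le_trans (c1P k))// lerDl.
  have -> : X `&` [set N] = set0.
    by apply/seteqP; split => i //= [Xi iN]; apply: XNN; rewrite -iN.
  by rewrite (le_trans (c0P k))// lerDr.
by apply/seteqP; split => i //= [[_ /= iN] [_ iE]]; rewrite iE ltnn in iN.
Qed.

(* A gliding hump: [nu (k i)] is large at [k i], controlled on the earlier
   points by [finite_dominated] and small on the later ones by [thin]. *)
Lemma diagonal_bounded (nu : nat -> set nat -> R) :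
  (forall k, additive_on setT (nu k)) ->
  (forall k, exists B, dominated_on setT (nu k) B) ->
  (forall L, exists c, forall k, `|nu k L| <= c) ->
  exists M, forall k, `|nu k [set k]| <= M.
Proof.
move=> nuD nuB nuP; apply: contrapT => unbd.
have /choice[C CP] := finite_dominated nuD nuP.
have far (M : R) (N : nat) : exists2 k, (N < k)%N & M < `|nu k [set k]|.
  apply: contrapT => no; apply: unbd.
  have [B BP] : exists B, forall k, (k <= N)%N -> `|nu k [set k]| <= B.
    elim: N {no} => [|N [B BP]].
      by exists (`|nu 0%N [set 0%N]|) => k; rewrite leqn0 => /eqP ->.
    exists (Num.max B (`|nu N.+1 [set N.+1]|)) => k.
    rewrite leq_eqVlt => /orP[/eqP->|kN]; first by rewrite le_max lexx orbT.
    by rewrite le_max BP.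
  exists (Num.max B M) => k; rewrite le_max; have [kN|Nk] := leqP k N.
    by rewrite BP.
  have [_|kM] := leP (`|nu k [set k]|) M; first by rewrite orbT.
  by exfalso; apply: no; exists k.
pose hump (f : nat -> nat) :=
  increasing f /\ forall i, i%:R <= `|nu (f i) [set f i]|.
have [f0 hump0] : exists f, hump f.
  have [|k _|f f00 fP] := @dependent_sequence nat xpredT
    (fun k l => (k < l)%N /\ `|nu k [set k]| + 1 < `|nu l [set l]|) 0%N => //.
    by have [l] := far (`|nu k [set k]| + 1) k; exists l.
  exists f; split; first by apply: increasingS => i; case: (fP i) => _ [].
  elim=> // i ih; rewrite -natr1; apply: le_trans (ltW (fP i).2.2).
  by rewrite lerD2r.
(* Budget for the head of [g]: [C (f 0).+1] for the points up to [f 0], 1 for the points after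
   [g 0], and a remainder [f 0 + 1] that outgrows any fixed bound. *)
pose Q (f g : nat -> nat) := [/\ range g `<=` range f, (f 0 < g 0)%N,
  forall L, L `<=` range g -> `|nu (f 0%N) L| <= 1 &
  C (f 0%N).+1 + (f 0%N)%:R + 2 <= `|nu (g 0%N) [set g 0%N]|].
have [//||F F0 FP] := @dependent_sequence _ hump Q f0.
  move=> f [f_inc f_ge].
  have fS_inc : increasing (f \o succn) by move=> i j ij; exact: f_inc.
  have [B nufB] := nuB (f 0%N).
  have [g g_inc gP] := thin (nuD _) nufB fS_inc.
  (* The [i]-th mass is at least [i], so dropping [m] terms makes the new head large enough. *)
  pose m := Num.bound (C (f 0%N).+1 + (f 0%N)%:R + 2).
  exists (f \o succn \o g \o addn m).
    split=> [i j ij|i] /=; first by apply/f_inc/g_inc; rewrite ltn_add2l.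
    apply: le_trans (f_ge _); rewrite ler_nat.
    have := increasing_ge (m + i) g_inc; lia.
  split=> [_ [i _ <-]|||] /=.
  - by exists (g (m + i)).+1.
  - exact: f_inc.
  - by move=> L Lf; apply: gP => i /Lf[j _ <-]; exists (m + j)%N.
  - apply: le_trans (f_ge _); apply: (@le_trans _ _ m%:R).
      exact/ltW/ltr_bound.
    rewrite ler_nat; have := increasing_ge (m + 0) g_inc; lia.
pose k i := F i 0%N.
have k_inc : increasing k by apply: increasingS => i; case: (FP i) => _ [].
have nest i j : (i <= j)%N -> range (F j) `<=` range (F i).
  elim: j => [|j ih]; first by rewrite leqn0 => /eqP ->.
  rewrite leq_eqVlt => /orP[/eqP -> //|/ih]; apply: subset_trans.
  by case: (FP j) => _ [].
have [c cP] := nuP (range k).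
pose i := Num.bound c.
have [_ [_ _ _ big]] := FP i.
have [_ [_ kS small _]] := FP i.+1.
have := cP (k i.+1); apply/negP; rewrite -ltNge.
(* Earlier humps, the hump [k i.+1] itself, later humps: the middle one dominates. *)
have -> : range k = (range k `&` `I_(k i).+1) `|`
    ([set k i.+1] `|` (range k `&` [set j | (k i.+1 < j)%N])).
  apply/seteqP; split; last first.
    by move=> _ [[]//|[->|[]//]]; exists i.+1.
  move=> _ [j _ <-]; have [ji|ij|ij] := ltngtP j i.+1.
  - left; split; [by exists j|].
    by rewrite /= ltnS; apply: increasing_leq.
  - by right; right; split; [exists j|exact: k_inc].
  - by right; left; rewrite -ij.
rewrite !nuD//; last 2 first.
- by apply/seteqP; split => // j [-> [_ /=]]; rewrite ltnn.
- apply/seteqP; split => // j [[_ /= jk] [jE|[_ /= kj]]].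
    by rewrite jE /= ltnS leqNgt k_inc in jk.
  have := ltn_trans kj jk; rewrite ltnS leqNgt.
  by rewrite k_inc.
set a := nu _ (_ `&` `I_ _); set b := nu _ [set _]; set e := nu _ (_ `&` _).
have ha : `|a| <= C (k i).+1 by apply: CP => j [].
have he : `|e| <= 1.
  apply: small => _ [[j _ <-] /= ij].
  apply: (nest i.+2 j); last by exists 0%N.
  by rewrite ltnNge; apply/negP => ji; move: ij; rewrite ltnNge increasing_leq.
have ci : c < (k i)%:R.
  apply: lt_le_trans (ltr_bound _) _.
  by rewrite ler_nat; exact: increasing_ge.
have hb : C (k i).+1 + (k i)%:R + 2 <= `|b| by [].
have : `|b| <= `|a + (b + e)| + `|a| + `|e|.
  have {1}-> : b = a + (b + e) - a - e by ring.
  by rewrite (le_trans (ler_normB _ _))// lerD2r ler_normB.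
lra.
Qed.
End thinning.

(** * Sets on which a sequence of measures is unbounded *)

Section bad_sets.
Context {R : realType} (J : set (set nat)) (g : nat -> set nat -> R).
Context (J_sub : forall X Y, X `<=` Y -> J Y -> J X).
Context (gD : forall n, additive_on J (g n)).
Context (gB : forall n, exists B, dominated_on J (g n) B).
Context (gP : forall X, J X -> exists c, forall n, `|g n X| <= c).

Definition bad (X : set nat) :=
  forall M : R, exists n A, [/\ J A, A `<=` X & M < `|g n A|].

(** Along the pieces, [g (n_ k)] induces a measure on all sets of indices, whose value at [[set k]]
    is that of [g (n_ k)] at [F k]; [diagonal_bounded] applies to these measures. *)
Lemma disjoint_sequence_bounded (F : nat -> set nat) (n_ : nat -> nat) :
  trivIset setT F -> (forall L, J (\bigcup_(k in L) F k)) ->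
  ~ forall k, k%:R < `|g (n_ k) (F k)|.
Proof.
move=> tF JF big.
have [||L|M MP] := @diagonal_bounded R
    (fun k L => g (n_ k) (\bigcup_(j in L) F j)).
- move=> k X Y _ _ XY; rewrite bigcup_setU gD//.
  apply/seteqP; split => // i [[a Xa Fa] [b Yb Fb]].
  have ab : a = b by apply: (tF a b) => //; exists i.
  have XYa : (X `&` Y) a by split => //; rewrite ab.
  by rewrite XY in XYa.
- by move=> k; have [B BP] := gB (n_ k); exists B => X _; exact: BP.
- by have [c cP] := gP (JF L); exists c.
have := big (Num.bound M); apply/negP; rewrite -leNgt.
have := MP (Num.bound M); rewrite bigcup_set1 => /le_trans; apply.
exact/ltW/ltr_bound.
Qed.

(** Greedy exhaustion: each piece is removed from the current set, which keeps [P], so that all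
    later pieces avoid it. *)
Lemma disjoint_sequence_choice (P : set nat -> Prop)
    (D : nat -> set nat -> Prop) X0 :
  P X0 ->
  (forall k X, P X -> exists F n,
    [/\ F `<=` X, P (X `\` F), D k F & k%:R < `|g n F|]) ->
  exists F n_, trivIset setT F /\
    forall k, D k (F k) /\ k%:R < `|g (n_ k) (F k)|.
Proof.
move=> PX0 step.
pose Q (s t : nat * set nat) := t.1 = s.1.+1 /\ exists F n,
  [/\ F `<=` s.2, t.2 = s.2 `\` F, D s.1 F & s.1%:R < `|g n F|].
have [//||f f0 fP] := @dependent_sequence _ (fun s => P s.2) Q (0%N, X0).
  move=> [k X] /= /(step k)[F [n [FX PXF DF kF]]].
  by exists (k.+1, X `\` F) => //; split => //; exists F, n.
have f1 k : (f k).1 = k.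
  by elim: k => [|k ih]; [rewrite f0|case: (fP k) => _ [-> _]; rewrite ih].
have /choice[F] : forall k, exists F, exists n,
    [/\ F `<=` (f k).2, (f k.+1).2 = (f k).2 `\` F, D k F & k%:R < `|g n F|].
  by move=> k; have [_ [_ ]] := fP k; rewrite f1.
move=> /choice[n_ FP]; exists F, n_; split; last by move=> k; case: (FP k).
have dec j k : (j <= k)%N -> (f k).2 `<=` (f j).2.
  elim: k => [|k ih]; first by rewrite leqn0 => /eqP ->.
  rewrite leq_eqVlt => /orP[/eqP -> //|/ih]; apply: subset_trans.
  by have [_ -> _ _] := FP k; exact: subDsetl.
have disj j k : (j < k)%N -> F j `&` F k = set0.
  move=> jk; apply/seteqP; split => // i [Fj Fk].
  have [Fkf _ _ _] := FP k; have := dec _ _ jk _ (Fkf _ Fk).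
  by have [_ -> _ _] := FP j => -[].
apply/trivIsetP => j k _ _; rewrite neq_lt => /orP[|/disj]; first exact: disj.
by rewrite setIC.
Qed.

(** A subset of the union splits into its part in [X] and its part in [Y] outside [X], so bounds on
    both sides add up. *)
Lemma bad_setU X Y : bad (X `|` Y) -> bad X \/ bad Y.
Proof.
move=> bXY; apply: contrapT => /not_orP[].
move=> /existsNP[M1 M1P] /existsNP[M2 M2P].
have [n [A [JA AXY nA]]] := bXY (`|M1| + `|M2|).
have JAX : J (A `&` X) by apply: J_sub JA; exact: subIsetl.
have JAY : J (A `&` (Y `\` X)) by apply: J_sub JA; exact: subIsetl.
have : g n A = g n (A `&` X) + g n (A `&` (Y `\` X)).
  rewrite -gD//; last first.
    by apply/seteqP; split => // i [[_ Xi] [_ [_ /(_ Xi)]]].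
  congr (g n _); apply/seteqP; split => [i Ai|i [|] []//].
  by have [Xi|nXi] := pselect (X i); [left|right; case: (AXY _ Ai)].
have h1 : `|g n (A `&` X)| <= M1.
  rewrite leNgt; apply/negP => h; apply: M1P; exists n, (A `&` X).
  by split => //; exact: subIsetr.
have h2 : `|g n (A `&` (Y `\` X))| <= M2.
  rewrite leNgt; apply/negP => h; apply: M2P; exists n, (A `&` (Y `\` X)).
  by split => // i [_ []].
move=> gE; move: nA; apply/negP; rewrite -leNgt gE.
apply: le_trans (ler_normD _ _) _; apply: lerD.
  exact: le_trans (ler_norm _).
exact: le_trans (ler_norm _).
Qed.

(* The Nikodym theorem for the full power set of [E]. *)
Lemma not_bad_in_ideal E : J E -> ~ bad E.
Proof.
move=> JE badE.
have [|k X [XE badX]|F [n_ [tF FP]]] := @disjoint_sequence_choice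
    (fun X => X `<=` E /\ bad X) (fun _ F => F `<=` E) E.
- by split.
- have JX := J_sub XE JE; have [c cP] := gP JX.
  (* As [c] bounds the mass of [X], both [A] and the rest of [X] get mass above [k] in absolute
     value. One of them is bad and is kept; the other becomes the next piece. *)
  have [n [A [JA AX kA]]] := badX (k%:R + c).
  have XA : X = A `|` (X `\` A) by rewrite setDUK.
  have JXA : J (X `\` A) by apply: J_sub JX; exact: subDsetl.
  have gX : g n X = g n A + g n (X `\` A).
    by rewrite {1}XA gD// setDIK.
  have c0 : 0 <= c by apply: le_trans (cP 0%N).
  have kXA : k%:R < `|g n (X `\` A)|.
    have : `|g n A| <= `|g n X| + `|g n (X `\` A)|.
      by rewrite gX -{1}[g n A](addrK (g n (X `\` A))) ler_normB.
    have := cP n; lra.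
  have XAE : X `\` A `<=` E by move=> i [/XE].
  have [badA|badXA] : bad A \/ bad (X `\` A) by apply: bad_setU; rewrite -XA.
    exists (X `\` A), n; split => //.
    by rewrite setDD; split => [i []|]; [move=> /XE|rewrite setIidr].
  exists A, n; split; [by []|by split|exact: subset_trans XE|lra].
- apply: (@disjoint_sequence_bounded F n_) => // [L|k]; last by case: (FP k).
by apply: J_sub JE => i [k _]; case: (FP k) => FE _; apply: FE.
Qed.

End bad_sets.

(** * Block densities *)

Definition block_count (m : nat) (A : set nat) : nat :=
  \sum_(2 ^ m <= k < 2 ^ m.+1) `[< A k >].

Lemma block_count_le m (A B : set nat) :
  (forall k, (2 ^ m <= k < 2 ^ m.+1)%N -> A k -> B k) ->
  (block_count m A <= block_count m B)%N.
Proof.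
move=> AB; rewrite /block_count !big_nat; apply: leq_sum => k km.
have := AB k km; case: asboolP => // Ak /(_ Ak) Bk.
by rewrite asboolT.
Qed.

Lemma block_countU m (A B : set nat) :
  (block_count m (A `|` B) <= block_count m A + block_count m B)%N.
Proof.
rewrite /block_count -big_split /=; apply: leq_sum => k _.
case: asboolP => // -[Ak|Bk]; first by rewrite asboolT.
by rewrite addnC asboolT.
Qed.

Lemma block_countT m : block_count m setT = (2 ^ m)%N.
Proof.
rewrite /block_count (eq_bigr (fun=> 1%N)); last by move=> k _; rewrite asboolT.
by rewrite sum_nat_const_nat muln1 expnS mul2n -addnn addnK.
Qed.

Lemma sum_residue q a r : (r < q)%N ->
  (\sum_(0 <= j < a * q) (j %% q == r) = a)%N.
Proof.
move=> rq; elim: a => [|a ih]; first by rewrite mul0n big_geq.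
rewrite (@big_cat_nat _ _ _ (a * q)) ?leq_mul//= ih mulSn -{1}[(a * q)%N]add0n.
rewrite big_addn addnK (eq_big_nat _ _ (F2 := fun j => (j == r : nat))); last first.
  by move=> j /andP[_ jq]; rewrite addnC modnMDl modn_small.
rewrite (bigD1_seq r) ?iota_uniq ?mem_index_iota//= eqxx big1; last first.
  by move=> j /negPf ->.
by rewrite addn0 addn1.
Qed.

(** For [m < k] block [m] lies below [2 ^ k]; for [k <= m] it starts at a multiple of [2 ^ k] and
    consists of [2 ^ (m - k)] full periods. *)
Lemma block_count_residue k m r : (r < 2 ^ k)%N ->
  (block_count m [set j | 2 ^ k <= j /\ j %% 2 ^ k = r] * 2 ^ k <= 2 ^ m)%N.
Proof.
move=> rk; have [mk|km] := ltnP m k.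
  rewrite /block_count big_nat big1 ?mul0n// => j /andP[_ jm].
  rewrite asboolF//= => -[kj _]; move: jm.
  by rewrite ltnNge (leq_trans _ kj)// leq_exp2l.
have e : (2 ^ m = 2 ^ (m - k) * 2 ^ k)%N by rewrite -expnD subnK.
rewrite [leqRHS]e leq_mul2r; apply/orP; right.
rewrite -[leqRHS](@sum_residue (2 ^ k)%N _ r)// -e /block_count.
rewrite -{1}[(2 ^ m)%N]add0n big_addn expnS mul2n -addnn addnK.
apply: leq_sum => j _; case: asboolP => // -[_]; rewrite e addnC modnMDl => ->.
by rewrite eqxx.
Qed.

Section density.
Context {R : realType}.

Definition density (m : nat) (A : set nat) : R := (block_count m A)%:R / 2 ^+ m.

Lemma density_ge0 m A : 0 <= density m A.
Proof. by rewrite divr_ge0// exprn_ge0. Qed.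

Lemma density_le m (A B : set nat) :
  (forall k, (2 ^ m <= k < 2 ^ m.+1)%N -> A k -> B k) ->
  density m A <= density m B.
Proof.
move=> AB; rewrite ler_pM2r ?invr_gt0 ?exprn_gt0// ler_nat.
exact: block_count_le.
Qed.

Lemma densityU m (A B : set nat) :
  density m (A `|` B) <= density m A + density m B.
Proof.
rewrite -mulrDl ler_pM2r ?invr_gt0 ?exprn_gt0// -natrD ler_nat.
exact: block_countU.
Qed.

Lemma densityT m : density m setT = 1.
Proof. by rewrite /density block_countT natrX divff// expf_neq0. Qed.

Lemma density0 m (A : set nat) :
  (forall k, (2 ^ m <= k < 2 ^ m.+1)%N -> ~ A k) -> density m A = 0.
Proof.
move=> nA; rewrite /density /block_count big_nat big1 ?mul0r// => k /nA nAk.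
by rewrite asboolF.
Qed.

Lemma density_residue k m r : (r < 2 ^ k)%N ->
  density m [set j | (2 ^ k <= j)%N /\ (j %% 2 ^ k)%N = r] <= 2 ^- k.
Proof.
move=> rk; rewrite ler_pdivrMr ?exprn_gt0// mulrC ler_pdivlMr ?exprn_gt0//.
by rewrite -!natrX -natrM ler_nat block_count_residue.
Qed.

End density.

Lemma block_uniq m n k :
  (2 ^ m <= k < 2 ^ m.+1)%N -> (2 ^ n <= k < 2 ^ n.+1)%N -> m = n.
Proof.
move=> /andP[a b] /andP[c d]; apply/eqP; rewrite eqn_leq.
have := leq_ltn_trans a d; have := leq_ltn_trans c b.
by rewrite !ltn_exp2l// !ltnS => -> ->.
Qed.

(* [branch_code x n] has the binary expansion [1 x_0 ... x_(n-1)], so that the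
   codes of distinct branches are almost disjoint. *)
Fixpoint branch_code (x : nat -> bool) (n : nat) : nat :=
  if n is n'.+1 then (branch_code x n').*2 + x n' else 1.

Lemma branch_code_range x n : (2 ^ n <= branch_code x n < 2 ^ n.+1)%N.
Proof.
elim: n => // n /andP[h1 h2] /=; rewrite expnS mul2n [(2 ^ n.+2)%N]expnS mul2n.
rewrite (leq_trans _ (leq_addr _ _)) ?leq_double//=.
case: (x n); rewrite ?addn1 ?addn0 ?ltn_double//.
by rewrite ltn_Sdouble.
Qed.

Lemma branch_code_gt x n : (n < branch_code x n)%N.
Proof.
have /andP[h _] := branch_code_range x n.
exact: leq_trans (ltn_expl _ _) h.
Qed.

(** The position of the leading digit gives the length, and halving strips the digits one at a
    time. *)
Lemma branch_code_inj x y m n : branch_code x m = branch_code y n ->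
  m = n /\ forall i, (i < n)%N -> x i = y i.
Proof.
move=> xy; have mn : m = n.
  apply: (block_uniq (branch_code_range x m)).
  by rewrite xy; exact: branch_code_range.
split=> //; subst m; elim: n xy => // n ih /= xy.
have hxy : branch_code x n = branch_code y n.
  by move: xy => /(congr1 half); rewrite -![(_.*2 + _)%N]addnC !half_bit_double.
have exy : x n = y n.
  move: xy => /(congr1 odd); rewrite !oddD !odd_double /=.
  by case: (x n); case: (y n).
by move=> i; rewrite ltnS leq_eqVlt => /orP[/eqP -> //|]; exact: ih.
Qed.

(** * The density ideal of a set of branches *)

Section branch_ideal.
Context (R : realType).
Implicit Types S : set (nat -> bool).

Lemma squeeze_cvg0 (u v : nat -> R) : (forall n, 0 <= u n <= v n) ->
  v @ \oo --> (0 : R) -> u @ \oo --> (0 : R).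
Proof.
move=> uv v0; apply: (@squeeze_cvgr _ _ _ _ (fun=> 0) v) => //.
  by near=> n; exact: uv.
exact: cvg_cst.
Unshelve. all: by end_near. Qed.

Definition branch_ideal S : set (set nat) :=
  [set A | forall x, S x ->
    density (branch_code x n) A @[n --> \oo] --> (0 : R)].

Lemma branch_ideal_sub S X Y : X `<=` Y -> branch_ideal S Y -> branch_ideal S X.
Proof.
move=> XY JY x Sx; apply: squeeze_cvg0 (JY x Sx) => n.
by rewrite density_ge0 density_le// => k _; exact: XY.
Qed.

Lemma branch_idealU S X Y :
  branch_ideal S X -> branch_ideal S Y -> branch_ideal S (X `|` Y).
Proof.
move=> JX JY x Sx.
pose d A n : R := density (branch_code x n) A.
have h : (fun n => d X n + d Y n) @ \oo --> (0 : R).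
  by rewrite -[0 : R]addr0; apply: cvgD (JX x Sx) (JY x Sx).
apply: squeeze_cvg0 h => n.
by rewrite density_ge0 densityU.
Qed.

Lemma branch_ideal_bounded S N : branch_ideal S `I_N.
Proof.
move=> x _; apply: cvg_near_cst; near=> n.
apply: density0 => k /andP[nk _] /= kN.
have : (n < N)%N.
  apply: ltn_trans kN; apply: leq_trans nk; apply: ltn_trans (ltn_expl _ _) => //.
  exact: branch_code_gt.
by apply/negP; rewrite -leqNgt; near: n; exact: nbhs_infty_ge.
Unshelve. all: by end_near. Qed.

Lemma not_branch_ideal S x A : S x ->
  (forall n, density (branch_code x n) A = 1 :> R) ->
  ~ branch_ideal S A.
Proof.
move=> Sx A1 JA; have /cvgrPdist_lt/(_ _ ltr01)[N _ /(_ N (leqnn N))] := JA x Sx.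
by rewrite /= A1 sub0r normrN normr1 ltxx.
Qed.

Lemma branch_idealT S x : S x -> ~ branch_ideal S setT.
Proof. by move=> Sx; apply: (not_branch_ideal Sx) => n; exact: densityT. Qed.

(** The densities [2 ^- k] are summable uniformly in the block, and the bound [2 ^ k <= j] lets only
    pieces with [k <= m] meet block [m]. *)
Definition thin_piece S k (F : set nat) := [/\ branch_ideal S F,
  forall j, F j -> (2 ^ k <= j)%N & forall m, density m F <= 2 ^- k :> R].

(** The first [a] pieces form a set of the ideal, and the others have total density at most
    [2 * 2 ^- a] in every block. *)
Lemma branch_ideal_bigcup S (F : nat -> set nat) L :
  (forall k, thin_piece S k (F k)) -> branch_ideal S (\bigcup_(k in L) F k).
Proof.
move=> FP x Sx; apply/cvgrPdist_lt => e e0.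
pose U a b := \bigcup_(k in L `&` [set k | (a <= k < b)%N]) F k.
have J_U a b : branch_ideal S (U a b).
  elim: b => [|b ih].
    apply: (branch_ideal_sub _ (@branch_ideal_bounded S 0)) => i [k [_ /=]].
    by rewrite ltn0 andbF.
  have [Fb _ _] := FP b; apply: (branch_ideal_sub _ (branch_idealU ih Fb)) => i.
  move=> [k [Lk /= /andP[ak]]]; rewrite ltnS leq_eqVlt => /orP[/eqP ->|kb] Fk.
    by right.
  by left; exists k => //; split => //; rewrite /= ak.
have density_tail m a b : (a <= b)%N ->
    density m (U a b) <= 2 * 2 ^- a - 2 * 2 ^- b :> R.
  elim: b => [|b ih].
    rewrite leqn0 => /eqP ->; rewrite subrr density0// => i _ [k [_ /=]].
    by rewrite ltn0.
  rewrite leq_eqVlt => /orP[/eqP <-|].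
    rewrite subrr density0// => i _ [k [_ /= /andP[h]]].
    by rewrite ltnNge h.
  rewrite ltnS => ab; have [_ _ Fb] := FP b.
  apply: (@le_trans _ _ (density m (U a b) + density m (F b))).
    apply: le_trans (densityU _ _ _); apply: density_le => i _.
    move=> [k [Lk /= /andP[ak]]]; rewrite ltnS leq_eqVlt => /orP[/eqP ->|kb] Fk.
      by right.
    by left; exists k => //; split => //; rewrite /= ak.
  apply: le_trans (lerD (ih ab) (Fb m)) _.
  rewrite exprS invfM mulrA mulfV// mul1r; lra.
have [a ha] : exists a, 2 * 2 ^- a < e / 2.
  exists (Num.bound (4 / e)).
  set a := Num.bound _; have : 4 / e < a%:R := ltr_bound _.
  have : a%:R < 2 ^+ a :> R by rewrite -natrX ltr_nat ltn_expl.
  move=> h1 h2; have h3 := lt_trans h2 h1.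
  rewrite ltr_pdivrMr// in h3.
  rewrite ltr_pdivrMr ?exprn_gt0//; lra.
have := J_U 0%N a x Sx => /cvgrPdist_lt /(_ (e / 2)).
rewrite divr_gt0// => /(_ isT) hU; near=> n.
rewrite sub0r normrN ger0_norm ?density_ge0//.
have h1 : density (branch_code x n) (U 0%N a) < e / 2 :> R.
  have : `|0 - density (branch_code x n) (U 0%N a)| < e / 2 :> R by near: n.
  by rewrite sub0r normrN ger0_norm ?density_ge0.
set m := branch_code x n in h1 *.
(* Pieces beyond [m] miss block [m], so a finite union suffices there. *)
have le_U : density m (\bigcup_(k in L) F k) <=
    density m (U 0%N a) + density m (U a (maxn a m.+1)) :> R.
  apply: le_trans (densityU _ _ _); apply: density_le => i /andP[_ im] [k Lk Fk].
  have [ka|ak] := ltnP k a; [left|right]; exists k => //; split => //=.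
  rewrite ak leq_max; apply/orP; right.
  have [_ /(_ _ Fk) ki _] := FP k.
  by have := leq_ltn_trans ki im; rewrite ltn_exp2l.
apply: le_lt_trans le_U _.
have h2 := density_tail m _ _ (leq_maxl a m.+1).
have h3 : 0 < 2 ^- (maxn a m.+1) :> R by rewrite invr_gt0 exprn_gt0.
lra.
Unshelve. all: by end_near. Qed.

(** If every residue class carried at most [c], the [q] classes together would carry at most
    [c * q]. *)
Lemma residue_pigeonhole (J : set (set nat)) (g : set nat -> R) (A : set nat) q c :
  (forall X Y, X `<=` Y -> J Y -> J X) -> additive_on J g -> J A -> (0 < q)%N ->
  c * q%:R < `|g A| ->
  exists2 r, (r < q)%N & c < `|g (A `&` [set j | (j %% q)%N = r])|.
Proof.
move=> J_sub gD JA q0 cA; apply: contrapT => no.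
have JI X : J (A `&` X) by apply: J_sub JA; exact: subIsetl.
have le M : (M <= q)%N ->
    `|g (A `&` [set j | (j %% q < M)%N])| <= c * M%:R.
  elim: M => [_|M ih Mq].
    have -> : A `&` [set j | (j %% q < 0)%N] = set0.
      by apply/seteqP; split => // i [].
    have J0 : J set0 by apply: J_sub JA; exact: sub0set.
    have := gD _ _ J0 J0 (setI0 _); rewrite setU0 => /eqP.
    by rewrite -subr_eq subrr => /eqP <-; rewrite normr0 mulr0.
  have -> : A `&` [set j | (j %% q < M.+1)%N] =
      (A `&` [set j | (j %% q < M)%N]) `|` (A `&` [set j | (j %% q)%N = M]).
    rewrite -setIUr; congr (_ `&` _); apply/seteqP; split => i /=.
      by rewrite ltnS leq_eqVlt => /orP[/eqP|]; [right|left].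
    by case=> [/ltnW//|->].
  rewrite gD//; last first.
    by apply/seteqP; split => // i [[_ /= h] [_ /= e]]; rewrite e ltnn in h.
  apply: le_trans (ler_normD _ _) _; rewrite -natr1 mulrDr mulr1 lerD ?ih 1?ltnW//.
  by rewrite leNgt; apply/negP => h; apply: no; exists M.
have := le q (leqnn q); suff -> : A `&` [set j | (j %% q < q)%N] = A.
  by move=> /(lt_le_trans cA); rewrite ltxx.
by apply/seteqP; split => [i []//|i Ai]; split => //=; rewrite ltn_mod.
Qed.

(* Pieces of small density in every block have all their unions in the ideal,
   and a set in the ideal splits into finitely many of them. *)
Lemma branch_ideal_nikodym S (g : nat -> set nat -> R) :
  (forall n, additive_on (branch_ideal S) (g n)) ->
  (forall n, exists B, dominated_on (branch_ideal S) (g n) B) ->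
  (forall X, branch_ideal S X -> exists c, forall n, `|g n X| <= c) ->
  exists M, forall n, dominated_on (branch_ideal S) (g n) M.
Proof.
move=> gD gB gP; apply: contrapT => unbd.
have nbad := not_bad_in_ideal (@branch_ideal_sub S) gD gB gP.
have badU := bad_setU (@branch_ideal_sub S) gD.
have [||F [n_ [tF FP]]] := @disjoint_sequence_choice R g
  (bad (branch_ideal S) g) (thin_piece S) setT.
- move=> M; apply: contrapT => no; apply: unbd; exists M => n A JA.
  by rewrite leNgt; apply/negP => h; apply: no; exists n, A.
- move=> k X badX.
  (* The removed initial segment lies in the ideal, hence is not bad, so the rest is. *)
  have {}badX' : bad (branch_ideal S) g (X `\` `I_(2 ^ k)).
    have : bad (branch_ideal S) g ((X `&` `I_(2 ^ k)) `|` (X `\` `I_(2 ^ k))).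
      by rewrite setUIDK.
    move=> /badU[/nbad|//]; case.
    by apply: (branch_ideal_sub _ (@branch_ideal_bounded S (2 ^ k))) => i [].
  (* The factor [2 ^ k] pays for the pigeonhole over the residues modulo [2 ^ k]. *)
  have [n [A [JA AX kA]]] := badX' (k%:R * (2 ^ k)%:R).
  have [|r rk kr] := residue_pigeonhole (@branch_ideal_sub S) (gD n) JA _ kA.
    by rewrite expn_gt0.
  set F := _ `&` _ in kr; have JF : branch_ideal S F.
    by apply: (branch_ideal_sub _ JA) => i [].
  have FX : F `<=` X by move=> i [/AX[]].
  have Fk j : F j -> (2 ^ k <= j)%N.
    by move=> [/AX[_ /= /negP]]; rewrite -leqNgt.
  exists F, n; split => //.
  + have : bad (branch_ideal S) g (F `|` (X `\` F)) by rewrite setDUK.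
    by move=> /badU[/(nbad _ JF)|].
  + split => // m; apply: le_trans (density_residue m rk).
    by apply: density_le => j _ Fj; split; [exact: Fk|case: Fj].
- apply: (disjoint_sequence_bounded gD gB gP tF (n_ := n_)) => [L|k].
    by apply: branch_ideal_bigcup => k; case: (FP k).
  by case: (FP k).
Qed.

End branch_ideal.

(** * The algebras and the Nikodym property *)

Section ba_eval.
Context (R : realType) (A : subalgebra).
Local Notation B := (subalgebra_type A).

Definition subalgebra_elt X (AX : subalgebra_set A X) : B :=
  @SubalgebraType A X (asboolT AX).

(** Extension by 0 outside the algebra, so that the lemmas on set functions apply to measures on the
    subtype. *)
Definition ba_eval (mu : ba R B) (X : set nat) : R :=
  if pselect (subalgebra_set A X) is left AX then mu (subalgebra_elt AX) else 0.

Lemma subalgebra_valP (b : B) : subalgebra_set A (val b).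
Proof. exact: (asboolW (valP b)). Qed.

Lemma ba_evalE (mu : ba R B) (b : B) : ba_eval mu (val b) = mu b.
Proof.
rewrite /ba_eval; case: pselect => [Ab|/(_ (subalgebra_valP b))//].
by congr (mu _); exact: val_inj.
Qed.

Lemma ba_eval_elt (mu : ba R B) X (AX : subalgebra_set A X) :
  ba_eval mu X = mu (subalgebra_elt AX).
Proof. by rewrite -[X in LHS]/(val (subalgebra_elt AX)) ba_evalE. Qed.

Lemma ba_evalD (mu : ba R B) : additive_on A (ba_eval mu).
Proof.
move=> X Y AX AY XY; have AXY := subalgebraU AX AY.
have /asboolP[muD _] := valP mu.
rewrite !ba_eval_elt -muD.
  by congr (mu _); apply: val_inj; rewrite Order.valU_subproof.
by apply: val_inj; rewrite Order.valI_subproof Order.val0_subproof.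
Qed.

Lemma ba_eval_variation (mu : ba R B) X Y :
  subalgebra_set A X -> subalgebra_set A Y -> X `&` Y = set0 ->
  `|ba_eval mu X| + `|ba_eval mu Y| <= `|mu|.
Proof.
move=> AX AY XY; rewrite !ba_eval_elt; apply: ba_norm_ub.
by apply: val_inj; rewrite Order.valI_subproof Order.val0_subproof.
Qed.

Lemma ba_eval_le (mu : ba R B) : dominated_on A (ba_eval mu) `|mu|.
Proof.
move=> X AX; apply: le_trans (ba_eval_variation mu AX (subalgebra0 A) _).
  by rewrite lerDl.
by rewrite setI0.
Qed.

Lemma ba_eval0 (mu : ba R B) : ba_eval mu set0 = 0.
Proof.
have A0 := subalgebra0 A.
have := ba_evalD mu A0 A0 (setI0 _); rewrite setU0 => /eqP.
by rewrite -subr_eq subrr => /eqP <-.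
Qed.

Lemma ba_evalC (mu : ba R B) X : subalgebra_set A X ->
  ba_eval mu X = ba_eval mu setT - ba_eval mu (~` X).
Proof.
move=> AX; apply/eqP; rewrite eq_sym subr_eq -ba_evalD ?setUCr ?setICr//.
exact: subalgebraC.
Qed.

Lemma ba_eval_linear (k : R) (mu nu : ba R B) X :
  ba_eval (k *: mu + nu) X = k * ba_eval mu X + ba_eval nu X.
Proof. by rewrite /ba_eval; case: pselect => // _; rewrite mulr0 addr0. Qed.

Lemma pointwise_null_eval (mu : nat -> ba R B) : pointwise_null mu ->
  forall X, subalgebra_set A X -> exists c, forall n, `|ba_eval (mu n) X| <= c.
Proof.
move=> mu0 X AX.
have bnd := cvg_seq_bounded (cvgP _ (mu0 (subalgebra_elt AX))).
have [c [_ cP]] := bnd; exists (c + 1) => n; rewrite ba_eval_elt.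
by apply: cP => //; rewrite ltrDl.
Qed.

End ba_eval.

Section branch_algebra.
Context (R : realType).
Implicit Types S : set (nat -> bool).

Definition branch_algebra_set S : set (set nat) :=
  [set A | branch_ideal R S A \/ branch_ideal R S (~` A)].

Lemma branch_ideal0 S : branch_ideal R S set0.
Proof. by rewrite -II0; exact: branch_ideal_bounded. Qed.

Lemma branch_algebra0 S : branch_algebra_set S set0.
Proof. by left; exact: branch_ideal0. Qed.

Lemma branch_algebraC S X :
  branch_algebra_set S X -> branch_algebra_set S (~` X).
Proof. by case; [right; rewrite setCK|left]. Qed.

Lemma branch_algebraU S X Y :
  branch_algebra_set S X -> branch_algebra_set S Y ->
  branch_algebra_set S (X `|` Y).
Proof.
move=> [JX|JX] [JY|JY]; first by left; exact: branch_idealU.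
all: right; rewrite setCU.
- by apply: (branch_ideal_sub _ JY) => i [].
- by apply: (branch_ideal_sub _ JX) => i [].
- by apply: (branch_ideal_sub _ JX) => i [].
Qed.

Definition branch_algebra S : subalgebra :=
  Subalgebra (branch_algebra0 S) (@branch_algebraC S) (@branch_algebraU S).

Lemma branch_algebra_bounded S N X :
  X `<=` `I_N -> subalgebra_set (branch_algebra S) X.
Proof.
by move=> XN; left; apply: (branch_ideal_sub XN); exact: branch_ideal_bounded.
Qed.

Lemma branch_algebra1 S k : subalgebra_set (branch_algebra S) [set k].
Proof. by apply: (@branch_algebra_bounded S k.+1) => _ ->; exact: ltnSn. Qed.

Lemma nikodym_branch_algebra S : nikodym R (subalgebra_type (branch_algebra S)).
Proof.
move=> mu mu0; have muP := pointwise_null_eval mu0.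
have JA X : branch_ideal R S X -> subalgebra_set (branch_algebra S) X by left.
have [|||M MP] := @branch_ideal_nikodym R S (fun n => ba_eval (mu n)).
- by move=> n X Y /JA AX /JA AY; exact: ba_evalD.
- by move=> n; exists `|mu n| => X /JA; exact: ba_eval_le.
- by move=> X /JA; exact: muP.
have AT : subalgebra_set (branch_algebra S) setT.
  by rewrite -setC0; exact: subalgebraC (subalgebra0 _).
have [c cP] := muP _ AT.
(* [M] bounds the measures on the ideal and [c] at the whole space, hence [c + M] on complements;
   the variation norm adds two values. *)
exists ((c + M) + (c + M)); split; first exact: num_real.
move=> K /ltW cMK n _ /=; apply: le_trans cMK.
have M0 : 0 <= M by apply: le_trans (MP 0%N set0 (@branch_ideal0 S)).
have c0 : 0 <= c by apply: le_trans (cP 0%N).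
have bnd (b : subalgebra_type (branch_algebra S)) : `|mu n b| <= c + M.
  rewrite -ba_evalE; have [Jb|Jb] := subalgebra_valP b.
    by apply: le_trans (MP n _ Jb) _; rewrite lerDr.
  rewrite ba_evalC; last exact: subalgebra_valP.
  by apply: le_trans (ler_normB _ _) _; rewrite lerD// MP.
by apply: ba_norm_lub => a b _; rewrite lerD.
Qed.

End branch_algebra.

(** * Failure of the Grothendieck property *)

Section alternating_measure.
Context (R : realType).

Definition alternating (m : nat) (X : set nat) : R :=
  (\sum_(2 ^ m <= k < 2 ^ m.+1) (-1) ^+ k * (`[< X k >] : nat)%:R) / 2 ^+ m.

Lemma alternating_le m X : `|alternating m X| <= density m X.
Proof.
rewrite normrM [`|_^-1|]gtr0_norm ?invr_gt0 ?exprn_gt0//.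
rewrite ler_pM2r ?invr_gt0 ?exprn_gt0// /block_count natr_sum.
apply: le_trans (ler_norm_sum _ _ _) _; apply: ler_sum => k _.
by rewrite normrM normrX normrN1 expr1n mul1r ger0_norm.
Qed.

Lemma alternatingU m X Y : X `&` Y = set0 ->
  alternating m (X `|` Y) = alternating m X + alternating m Y.
Proof.
move=> XY; rewrite -mulrDl -big_split /=; congr (_ / _).
apply: eq_bigr => k _; rewrite -mulrDr -natrD; congr (_ * _%:R).
have [Xk|nXk] := pselect (X k).
  have nYk : ~ Y k by move=> Yk; have : (X `&` Y) k by []; rewrite XY.
  by rewrite (asboolT Xk) (asboolF nYk) asboolT//; left.
rewrite [`[< X k >]]asboolF//; congr nat_of_bool; apply: asbool_equiv_eq.
by split => [[]//|]; right.
Qed.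

(** The signs below an even bound cancel, and from block 1 on both ends of a block are even; block 0
    is the odd point 1 alone, hence [m.+1]. *)
Lemma alternatingT m : alternating m.+1 setT = 0.
Proof.
rewrite /alternating; suff -> : \sum_(2 ^ m.+1 <= k < 2 ^ m.+2)
    (-1) ^+ k * (`[< [set: nat] k >] : nat)%:R = 0 :> R by rewrite mul0r.
pose s n : R := \sum_(0 <= k < n) (-1) ^+ k * (`[< [set: nat] k >] : nat)%:R.
have s0 a : s a.*2 = 0.
  elim: a => [|a ih]; first by rewrite /s big_geq.
  rewrite /s doubleS !big_nat_recr//= -/(s _) ih !asboolT// !mulr1 exprS.
  by rewrite mulN1r add0r subrr.
have := s0 (2 ^ m.+1)%N; rewrite -mul2n -expnS /s.
rewrite (@big_cat_nat _ _ _ (2 ^ m.+1)) ?leq_exp2l//= -/(s _).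
have -> : s (2 ^ m.+1)%N = 0 by rewrite expnS mul2n s0.
by rewrite add0r.
Qed.

Lemma density_le1 m X : density m X <= 1 :> R.
Proof. by rewrite -(densityT m) density_le. Qed.

Lemma alternatingC m X : alternating m.+1 (~` X) = - alternating m.+1 X.
Proof.
apply/eqP; rewrite -addr_eq0 -alternatingU ?setICl// setUC setUCr.
by rewrite alternatingT.
Qed.

Lemma alternating_even m X :
  (forall k, (2 ^ m.+1 <= k < 2 ^ m.+2)%N -> X k <-> ~~ odd k) ->
  alternating m.+1 X = 1 / 2.
Proof.
move=> XP.
(* Pointwise, [1 + (-1) ^+ k] is twice the indicator of the even numbers. *)
have : density m.+1 setT + alternating m.+1 setT = 2 * alternating m.+1 X.
  rewrite /density /block_count natr_sum -mulrDl -big_split /= mulrA.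
  congr (_ / _); rewrite mulr_sumr !big_nat; apply: eq_bigr => k /XP Xk.
  rewrite -signr_odd asboolT// mulr1.
  rewrite (@asbool_equiv_eq _ (~~ odd k) Xk) asboolb.
  by case: odd; rewrite /= ?expr1 ?expr0; lra.
rewrite densityT alternatingT addr0; lra.
Qed.

Section alternating_ba.
Context (A : subalgebra).

Lemma alternating_is_ba m :
  (fun b : subalgebra_type A => alternating m (val b) : R^o) \in @is_ba R _ _.
Proof.
apply/asboolP; split => [a b ab|].
  rewrite Order.valU_subproof; apply: alternatingU.
  by move: (congr1 val ab); rewrite Order.valI_subproof Order.val0_subproof.
exists (1 + 1) => _ [a [b [_ ->]]].
by rewrite lerD// (le_trans (alternating_le _ _))// density_le1.
Qed.

Definition alternating_ba m : ba R (subalgebra_type A) := Ba (alternating_is_ba m).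

Lemma alternating_ba_norm m : `|alternating_ba m| <= 1 + 1.
Proof.
apply: ba_norm_lub => a b _.
by rewrite lerD// (le_trans (alternating_le _ _))// density_le1.
Qed.

End alternating_ba.

Section even_mass.
Context (S : set (nat -> bool)).
Local Notation A := (branch_algebra R S).
Local Notation B := (subalgebra_type A).
Implicit Types mu : ba R B.

Definition evens n : set nat := [set k | ~~ odd k && (k < n.*2)%N].

Lemma evensS n : evens n.+1 = evens n `|` [set n.*2].
Proof.
apply/seteqP; split => k; rewrite /evens /=.
  rewrite doubleS !ltnS => /andP[ok]; rewrite leq_eqVlt => /orP[/eqP kn|].
    by rewrite kn /= odd_double in ok.
  rewrite ltnS leq_eqVlt => /orP[/eqP ->|kn]; [by right|left].
  by rewrite ok.
case=> [/andP[-> kn]|->]; first by rewrite doubleS !ltnS ltnW// ltnW.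
by rewrite odd_double doubleS !ltnS leqnSn.
Qed.

Lemma evens_algebra n : subalgebra_set A (evens n).
Proof. by apply: (@branch_algebra_bounded R S n.*2) => k /andP[]. Qed.

Lemma evens_disj n : evens n `&` [set n.*2] = set0.
Proof.
by apply/seteqP; split => // k [/andP[_ kn] /= e]; rewrite e ltnn in kn.
Qed.

Lemma ba_eval_evens mu :
  (fun n => ba_eval mu (evens n)) = series (fun k => ba_eval mu [set k.*2]).
Proof.
apply/funext; elim=> [|n ih].
  rewrite /series /= big_geq//; have -> : evens 0 = set0; last exact: ba_eval0.
  by apply/seteqP; split => // k /andP[].
rewrite evensS ba_evalD ?ih.
- by rewrite /series /= big_nat_recr.
- exact: evens_algebra.
- exact: branch_algebra1.
- exact: evens_disj.
Qed.

(** Sorting the even points by the sign of their mass gives two disjoint finite sets [P] and [N],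
    and the sum is the mass of [P] minus that of [N]. *)
Lemma ba_eval_points mu n :
  \sum_(0 <= k < n) `|ba_eval mu [set k.*2]| <= `|mu|.
Proof.
have sub_evens X m : X `<=` evens m -> subalgebra_set A X.
  by move=> Xm; apply: (@branch_algebra_bounded R S m.*2) => k /Xm/andP[].
have [P [N [Pn Nn PN ->]]] : exists P N, [/\ P `<=` evens n, N `<=` evens n,
    P `&` N = set0 &
    \sum_(0 <= k < n) `|ba_eval mu [set k.*2]| = ba_eval mu P - ba_eval mu N].
  elim: n => [|n [P [N [Pn Nn PN e]]]].
    exists set0, set0; split => //; first by rewrite setI0.
    by rewrite big_geq// ba_eval0 subrr.
  have e1 : evens n `<=` evens n.+1 by rewrite evensS; exact: subsetUl.
  have e2 : [set n.*2] `<=` evens n.+1 by rewrite evensS; exact: subsetUr.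
  have disj X : X `<=` evens n -> X `&` [set n.*2] = set0.
    move=> Xn; apply/seteqP; split => // k [/Xn ek kn].
    by rewrite -(evens_disj n); split.
  rewrite big_nat_recr//= e; have A1 := branch_algebra1 R S n.*2.
  have [v0|v0] := leP 0 (ba_eval mu [set n.*2]).
    exists (P `|` [set n.*2]), N; split.
    - by rewrite subUset; split => //; exact: subset_trans e1.
    - exact: subset_trans e1.
    - by rewrite setIUl PN set0U setIC disj.
    - rewrite ba_evalD ?disj//; last exact: sub_evens Pn.
      by rewrite ger0_norm// addrAC.
  exists P, (N `|` [set n.*2]); split.
  - exact: subset_trans e1.
  - by rewrite subUset; split => //; exact: subset_trans e1.
  - by rewrite setIUr PN set0U disj.
  - rewrite ba_evalD ?disj//; last exact: sub_evens Nn.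
    by rewrite ltr0_norm// opprD addrA.
apply: le_trans (ba_eval_variation mu (sub_evens _ _ Pn) (sub_evens _ _ Nn) PN).
by apply: le_trans (ler_norm _) _; exact: ler_normB.
Qed.

Lemma cvg_evens mu : cvgn (fun n => ba_eval mu (evens n)).
Proof.
rewrite ba_eval_evens; apply: normed_cvg; apply: nondecreasing_is_cvgn.
  by apply: nondecreasing_series => n _ _ /=; exact: normr_ge0.
by exists `|mu| => _ [n _ <-]; exact: ba_eval_points.
Qed.

(** The set of all even numbers need not lie in the algebra, but its finite truncations do. *)
Definition even_mass mu : R^o := limn (fun n => ba_eval mu (evens n)).

Lemma even_mass_is_linear : linear even_mass.
Proof.
move=> k mu nu; rewrite /even_mass.
have -> : (fun n => ba_eval (k *: mu + nu) (evens n)) =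
    (k *: (fun n => ba_eval mu (evens n) : R^o)) + (fun n => ba_eval nu (evens n)).
  by apply/funext => n; rewrite ba_eval_linear.
rewrite limD.
- by rewrite limZr//; exact: cvg_evens.
- by apply: is_cvgZr; exact: cvg_evens.
- exact: cvg_evens.
Qed.

HB.instance Definition _ :=
  GRing.isLinear.Build R (ba R B) R^o *:%R even_mass even_mass_is_linear.

Lemma even_mass_le mu : `|even_mass mu| <= `|mu|.
Proof.
rewrite /even_mass -lim_norm; last exact: cvg_evens.
apply: limr_le; first by apply: is_cvg_norm; exact: cvg_evens.
by near=> n; apply: ba_eval_le; exact: evens_algebra.
Unshelve. all: by end_near. Qed.

Lemma continuous_even_mass : continuous even_mass.
Proof.
apply/linear_bounded_continuous; apply/ex_bound; exists 1.
near=> mu; apply: le_trans (even_mass_le mu) _; apply: ltW; near: mu.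
exact: nbhs0_lt.
Unshelve. all: by end_near. Qed.

Lemma even_mass_alternating m : even_mass (alternating_ba A m.+1) = 1 / 2.
Proof.
apply/cvg_lim => //; apply: cvg_near_cst; near=> n.
rewrite (ba_eval_elt _ (evens_algebra n)) /=.
apply: alternating_even => k /andP[_ km]; rewrite /evens /=.
split => [/andP[]//|->] /=; apply: leq_trans km _.
rewrite expnS mul2n leq_double; near: n; exact: nbhs_infty_ge.
Unshelve. all: by end_near. Qed.

Lemma not_grothendieck_branch_algebra x : S x -> ~ grothendieck R B.
Proof.
move=> Sx G.
pose mu n := alternating_ba A (branch_code x n).
(* Codes are positive, so block 0, where the total mass is not 0, never occurs. *)
have codeS n : exists m, branch_code x n = m.+1.
  exists (branch_code x n).-1.
  by rewrite prednK// (leq_ltn_trans _ (branch_code_gt x n)).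
have mu_bnd : bounded_fun mu.
  exists (1 + 1); split; first exact: num_real.
  by move=> K /ltW K1 n _ /=; apply: le_trans K1; exact: alternating_ba_norm.
have null_ideal X : branch_ideal R S X ->
    alternating (branch_code x n) X @[n --> \oo] --> (0 : R).
  move=> /(_ x Sx) X0; apply/norm_cvg0P; apply: squeeze_cvg0 X0 => n.
  by rewrite normr_ge0 alternating_le.
have mu0 : pointwise_null mu.
  move=> b; have [/null_ideal//|/null_ideal h] := subalgebra_valP b.
  rewrite -[0 : R^o]oppr0.
  have -> : (fun n => mu n b) =
      (fun n => - alternating (branch_code x n) (~` val b)).
    apply/funext => n; rewrite /mu; have [m ->] := codeS n.
    by rewrite alternatingC opprK.
  exact: cvgN.
have := G mu mu_bnd mu0 even_mass continuous_even_mass.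
have -> : (fun n => even_mass (mu n)) = (fun=> 1 / 2).
  apply/funext => n; rewrite /mu; have [m ->] := codeS n.
  exact: even_mass_alternating.
have d0 : 0 < 1 / 4 :> R by lra.
move=> /cvgrPdist_lt/(_ _ d0)[N _ /(_ N (leqnn N))] /=.
rewrite sub0r normrN ger0_norm; lra.
Qed.

End even_mass.
End alternating_measure.

(** * Counting isomorphic and analytic algebras *)

Section branch_set.
Context (R : realType).
Implicit Types S : set (nat -> bool).

Definition branch_set (x : nat -> bool) : set nat :=
  [set k | exists n, (2 ^ branch_code x n <= k < 2 ^ (branch_code x n).+1)%N].

Lemma branch_ideal_branch_set S x : ~ S x -> branch_ideal R S (branch_set x).
Proof.
move=> nSx y Sy; have [i xyi] : exists i, x i <> y i.
  apply/existsNP => xy; apply: nSx; suff -> : x = y by [].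
  exact/funext.
apply: cvg_near_cst; near=> n; apply: density0 => k ky [m kx].
have [_ /(_ i)] := branch_code_inj (block_uniq kx ky).
move=> /(_ _)/xyi; apply; near: n; exact: nbhs_infty_gt.
Unshelve. all: by end_near. Qed.

Lemma branch_ideal_branch_setC x : branch_ideal R [set x] (~` branch_set x).
Proof.
move=> _ ->; apply: cvg_near_cst; near=> n; apply: density0 => k kx; apply.
by exists n.
Unshelve. all: by end_near. Qed.

Lemma branch_ideal_restrict S x X :
  S x -> branch_ideal R S X -> branch_ideal R [set x] X.
Proof. by move=> Sx JX _ ->; exact: JX. Qed.

(** This recovers [S] from its algebra. For [S x], the blocks of [x] keep [branch_set x] out of the
    ideal, and those of the second branch [y] keep its complement out. *)
Lemma branch_algebra_branch_set S x y : S y -> x <> y ->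
  subalgebra_set (branch_algebra R S) (branch_set x) <-> ~ S x.
Proof.
move=> Sy xy; split; last by left; exact: branch_ideal_branch_set.
move=> + Sx => -[/(branch_ideal_restrict Sx) h|/(branch_ideal_restrict Sy) h].
  apply: (@branch_idealT R [set x] x) => //; rewrite -(setUCr (branch_set x)).
  by apply: branch_idealU => //; exact: branch_ideal_branch_setC.
apply: (@branch_idealT R [set y] y) => //; rewrite -(setUCr (branch_set x)).
by apply: branch_idealU => //; exact: branch_ideal_branch_set.
Qed.

Lemma branch_algebra_inj S S' x : S x -> S' x ->
  branch_algebra R S = branch_algebra R S' -> S = S'.
Proof.
move=> Sx S'x SS'; apply/funext => y; apply/propext.
have [->|xy] := pselect (y = x); first by [].
have := branch_algebra_branch_set Sx xy; rewrite SS'.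
by have := branch_algebra_branch_set S'x xy; split => h; apply: contrapT; tauto.
Qed.

End branch_set.

(** * Isomorphisms between algebras containing the singletons *)

Section isomorphism.
Implicit Types A B C : subalgebra.

Lemma boolean_isomorphic_refl A :
  boolean_isomorphic (subalgebra_type A) (subalgebra_type A).
Proof. by exists id; split => //; exists id. Qed.

Lemma boolean_isomorphic_sym A B :
  boolean_isomorphic (subalgebra_type A) (subalgebra_type B) ->
  boolean_isomorphic (subalgebra_type B) (subalgebra_type A).
Proof.
move=> [f [[g fK gK] fI fU fC]]; exists g; split; first by exists f.
- by move=> a b; apply: (can_inj fK); rewrite fI !gK.
- by move=> a b; apply: (can_inj fK); rewrite fU !gK.
- by move=> a; apply: (can_inj fK); rewrite fC !gK.
Qed.

Lemma boolean_isomorphic_trans A B C :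
  boolean_isomorphic (subalgebra_type A) (subalgebra_type B) ->
  boolean_isomorphic (subalgebra_type B) (subalgebra_type C) ->
  boolean_isomorphic (subalgebra_type A) (subalgebra_type C).
Proof.
move=> [f [f_bij fI fU fC]] [g [g_bij gI gU gC]]; exists (g \o f); split.
- exact: bij_comp.
- by move=> a b /=; rewrite fI gI.
- by move=> a b /=; rewrite fU gU.
- by move=> a /=; rewrite fC gC.
Qed.

(** The singletons are the atoms of both algebras, so [f] carries singletons to singletons and acts
    as the direct image under the induced [pi]. *)
Lemma isomorphic_image A B :
  (forall k, subalgebra_set A [set k]) -> (forall k, subalgebra_set B [set k]) ->
  boolean_isomorphic (subalgebra_type A) (subalgebra_type B) ->
  exists pi : nat -> nat,
    subalgebra_set B = (fun X => pi @` X) @` subalgebra_set A.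
Proof.
move=> A1 B1 [f [[g fK gK] fI fU fC]].
pose a k := subalgebra_elt (A1 k); pose b k := subalgebra_elt (B1 k).
have f0 : f \bot%O = \bot%O.
  by rewrite -(meetxC \bot%O) fI fC meetxC.
have valI C (u v : subalgebra_type C) k : val (u `&` v)%O k <-> val u k /\ val v k.
  by rewrite Order.valI_subproof.
have val0 C k : ~ val (\bot%O : subalgebra_type C) k.
  by rewrite Order.val0_subproof.
have meet_point C (C1 : forall k, subalgebra_set C [set k])
    (u : subalgebra_type C) k :
    val u k -> (u `&` subalgebra_elt (C1 k))%O = subalgebra_elt (C1 k).
  move=> uk; apply: val_inj; rewrite Order.valI_subproof.
  by apply/seteqP; split => [i []//|i /= ->]; split.
have meet_point0 C (C1 : forall k, subalgebra_set C [set k])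
    (u : subalgebra_type C) k :
    ~ val u k -> (u `&` subalgebra_elt (C1 k))%O = \bot%O.
  move=> uk; apply: val_inj; rewrite Order.valI_subproof Order.val0_subproof.
  by apply/seteqP; split => // i [ui /= ik]; apply: uk; rewrite -ik.
have nonempty C (u : subalgebra_type C) : u <> \bot%O -> exists k, val u k.
  move=> u0; apply: contrapT => /forallNP no; apply: u0; apply: val_inj.
  rewrite Order.val0_subproof; apply/seteqP; split => // k /no; exact.
have a0 k : a k <> \bot%O.
  by move=> /(congr1 val) ak; apply: (@val0 A k); rewrite -ak.
have b0 k : b k <> \bot%O.
  by move=> /(congr1 val) bk; apply: (@val0 B k); rewrite -bk.
(* The element [g (b l)] is nonzero and below [a k], so it contains [k]; hence [f (a k)] is below
   [b l], which is also below it. *)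
have fa_point k l : val (f (a k)) l -> f (a k) = b l.
  move=> kl; have e := meet_point B B1 _ _ kl.
  have gl0 : g (b l) <> \bot%O.
    by move=> gl; apply: (b0 l); rewrite -[b l]gK gl f0.
  have [j glj] := nonempty _ _ gl0.
  have e' : (a k `&` g (b l))%O = g (b l).
    by apply: (can_inj fK); rewrite fI gK.
  have jk : j = k by move: glj; rewrite -e' => /valI[].
  have := meet_point A A1 _ _ glj; rewrite jk -/(a k) => e2.
  have {}e2 : (f (a k) `&` b l)%O = f (a k) by rewrite meetC -{2}e2 fI gK.
  by rewrite -e2.
have /choice[pi piP] : forall k, exists l, f (a k) = b l.
  move=> k; have [|l kl] := nonempty _ (f (a k)); last by exists l; exact: fa_point.
  by move=> fak; apply: (a0 k); rewrite -[a k]fK fak -f0 fK.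
have fE u : val (f u) = pi @` (val u).
  (* For [l] in [f u], a point [k] of [g (b l)] satisfies [pi k = l]; were [k] outside [u], then
     [f u] and [b l] would be disjoint. *)
  apply/seteqP; split => [l ful|_ [k uk <-]].
    have gl0 : g (b l) <> \bot%O.
      by move=> gl; apply: (b0 l); rewrite -[b l]gK gl f0.
    have [k glk] := nonempty _ _ gl0.
    have fakl : f (a k) = b l.
      apply: fa_point; have := meet_point A A1 _ _ glk => /(congr1 f).
      rewrite fI gK piP => /(congr1 val) e.
      have : val (b (pi k)) (pi k) by [].
      by rewrite -[b (pi k)]piP -/(a k) in e *; rewrite -e => /valI[/= <-].
    have pikl : pi k = l.
      have := piP k; rewrite fakl => /(congr1 val) /= e.
      by have : [set l] l by []; rewrite e.
    exists k => //; apply: contrapT => nuk.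
    have := meet_point0 A A1 _ _ nuk => /(congr1 f); rewrite fI f0 fakl.
    by rewrite meet_point// => /b0.
  have := meet_point A A1 _ _ uk => /(congr1 f); rewrite fI piP => e.
  have : val (b (pi k)) (pi k) by [].
  by rewrite -e => /valI[].
exists pi; apply/seteqP; split => [Y BY|_ [X AX <-]].
  exists (val (g (subalgebra_elt BY))); first exact: subalgebra_valP.
  by rewrite -fE gK.
by have := subalgebra_valP (f (subalgebra_elt AX)); rewrite fE.
Qed.

End isomorphism.

Lemma char_fun_inj : injective char_fun.
Proof.
move=> X Y XY; apply/funext => n; apply/propext.
have := congr1 (fun u => u n) XY; rewrite /char_fun => e.
by split => h; apply/asboolP; [rewrite -e|rewrite e]; exact/asboolP.
Qed.

(** The default 0 of [nth] makes these the eventually zero sequences, a countable dense set. *)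
Definition baire_point (s : seq nat) : baire_space := fun n => nth 0%N s n.

Lemma baire_point_cvg (y : baire_space) :
  baire_point (mkseq y n) @[n --> \oo] --> y.
Proof.
apply/pointwise_cvgP => i.
suff : (fun n => baire_point (mkseq y n) i) @ \oo --> y i by [].
apply: cvg_near_cst; near=> n; rewrite /baire_point nth_mkseq//.
near: n; exact: nbhs_infty_gt.
Unshelve. all: by end_near. Qed.

Lemma continuous_baire_ext (f g : baire_space -> cantor_space) :
  continuous f -> continuous g -> f \o baire_point = g \o baire_point -> f = g.
Proof.
move=> cf cg fg; apply/funext => y.
have hf : f (baire_point (mkseq y n)) @[n --> \oo] --> f y.
  exact: (@cvg_comp _ _ _ (fun n => baire_point (mkseq y n)) f _ _ _
    (@baire_point_cvg y) (cf y)).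
have hg : g (baire_point (mkseq y n)) @[n --> \oo] --> g y.
  exact: (@cvg_comp _ _ _ (fun n => baire_point (mkseq y n)) g _ _ _
    (@baire_point_cvg y) (cg y)).
apply: (cvg_unique cantor_space_hausdorff hf).
suff -> : (fun n => f (baire_point (mkseq y n))) =
    (fun n => g (baire_point (mkseq y n))).
  exact: hg.
by apply/funext => n; exact: (congr1 (fun h => h (mkseq y n)) fg).
Qed.

(** * Embedding the Cantor space into the reals *)

Section ternary.
Context (R : realType).
Implicit Types b : nat -> bool.

(** Base 3 with digits 0 and 1 avoids the ambiguity of binary expansions: a first difference at
    place [i] outweighs all later digits, which sum to at most half of [3 ^- i]. *)
Definition ternary_sum b n : R := \sum_(0 <= k < n) (b k : nat)%:R / 3 ^+ k.

Lemma ternary_sum_le b m n : (m <= n)%N -> ternary_sum b m <= ternary_sum b n.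
Proof.
move=> mn; apply: nondecreasing_series mn => k _ _ /=.
by rewrite divr_ge0// exprn_ge0.
Qed.

Lemma ternary_sum_ge b m n : (m <= n)%N ->
  ternary_sum b n <= ternary_sum b m + 3 / 2 / 3 ^+ m - 3 / 2 / 3 ^+ n.
Proof.
elim: n => [|n ih]; first by rewrite leqn0 => /eqP ->; lra.
rewrite leq_eqVlt => /orP[/eqP ->|]; first lra.
rewrite ltnS => /ih {}ih; rewrite {1}/ternary_sum big_nat_recr//= -/(ternary_sum b n).
have t0 : 0 < (3 ^+ n)^-1 :> R by rewrite invr_gt0 exprn_gt0.
have : (b n : nat)%:R / 3 ^+ n <= (3 ^+ n)^-1 :> R.
  by rewrite -[leRHS]mul1r ler_pM2r//; case: (b n).
rewrite [3 ^+ n.+1]exprS invfM; lra.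
Qed.

Lemma ternary_sum_ub b m n :
  ternary_sum b n <= ternary_sum b m + 3 / 2 / 3 ^+ m.
Proof.
have t0 k : 0 < (3 ^+ k)^-1 :> R by rewrite invr_gt0 exprn_gt0.
have [mn|/ltnW nm] := leqP m n.
  by have := ternary_sum_ge b mn; have := t0 n; lra.
by have := ternary_sum_le b nm; have := t0 m; lra.
Qed.

Definition ternary b : R := sup (range (ternary_sum b)).

Lemma ternary_has_sup b : has_sup (range (ternary_sum b)).
Proof.
split; first by exists (ternary_sum b 0%N), 0%N.
exists (ternary_sum b 0%N + 3 / 2 / 3 ^+ 0) => _ [n _ <-].
exact: ternary_sum_ub.
Qed.

Lemma ternary_lt b b' i : (forall k, (k < i)%N -> b k = b' k) ->
  b i -> ~~ b' i -> ternary b' < ternary b.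
Proof.
move=> bb' bi b'i.
have eq_sum : ternary_sum b i = ternary_sum b' i.
  by apply: eq_big_nat => k /andP[_ /bb' ->].
have t0 : 0 < (3 ^+ i)^-1 :> R by rewrite invr_gt0 exprn_gt0.
have lo : ternary_sum b i + (3 ^+ i)^-1 <= ternary b.
  apply: sup_upper_bound; first exact: ternary_has_sup.
  by exists i.+1 => //; rewrite /ternary_sum big_nat_recr//= bi mul1r.
have hi : ternary b' <= ternary_sum b' i + (3 ^+ i)^-1 / 2.
  apply: sup_le_ub; first exact: (ternary_has_sup b').1.
  move=> _ [n _ <-]; apply: le_trans (ternary_sum_ub b' i.+1 n) _.
  rewrite /ternary_sum big_nat_recr//= (negPf b'i) mul0r addr0 exprS invfM.
  lra.
by rewrite eq_sum in lo; lra.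
Qed.

Lemma ternary_inj : injective ternary.
Proof.
move=> b b' tt; apply: contrapT => bb'.
have ex : exists i, b i != b' i.
  apply: contrapT => /forallNP no; apply: bb'; apply/funext => i.
  by have /negP := no i; rewrite negbK => /eqP.
have : ternary b != ternary b'; last by rewrite tt eqxx.
case: (ex_minnP ex) => i bi min.
have below k : (k < i)%N -> b k = b' k.
  by move=> ki; apply/eqP; apply: contraTT ki => /min; rewrite -leqNgt.
case bE : (b i); case b'E : (b' i); move: bi; rewrite bE b'E // => _.
- by rewrite gt_eqF// (ternary_lt below)// b'E.
- rewrite lt_eqF// (@ternary_lt b' b i)// ?bE// => k ki.
  by rewrite below.
Qed.

End ternary.

(** * Coding by branches and the diagonal argument *)

Section codes.
Context (R : realType).

(* The first kind of code is the action of an isomorphism on the atoms, the second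
   one is the restriction of a continuous function on the Baire space to the
   eventually zero sequences. *)
Definition code : Type := ((nat -> nat) + (seq nat -> nat -> bool))%type.

Local Notation probe := (nat * nat + seq nat * nat + rat + bool)%type.

(** Countably many bits that determine [c] and [r]. The probe [inr false] tells the two kinds of
    code apart, and [inr true] always holds, so that no code point is the zero branch. *)
Definition code_graph (c : code) (r : R) (w : probe) : bool :=
  match w with
  | inl (inl (inl (i, j))) => if c is inl p then p i == j else false
  | inl (inl (inr (s, j))) => if c is inr h then h s j else false
  | inl (inr q) => ratr q < r
  | inr b => b || (if c is inl _ then true else false)
  end.

Definition code_point (c : code) (r : R) (n : nat) : bool :=
  if unpickle n is Some w then code_graph c r w else false.

Lemma code_pointE c r w : code_point c r (pickle w) = code_graph c r w.
Proof. by rewrite /code_point pickleK. Qed.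

Lemma code_point_inj c r c' r' :
  code_point c r = code_point c' r' -> c = c' /\ r = r'.
Proof.
move=> e; have {}e w : code_graph c r w = code_graph c' r' w.
  by rewrite -!code_pointE e.
split; last first.
  have half u v : (forall q, (ratr q < u) = (ratr q < v)) -> ~ u < v :> R.
    move=> uv /rat_in_itvoo[q]; rewrite in_itv /= => /andP[uq qv].
    by have := uv q; rewrite qv => /lt_trans/(_ uq); rewrite ltxx.
  apply/eqP; rewrite eq_le !leNgt; apply/andP; split; apply/negP; apply: half => q.
    exact/esym/(e (inl (inr q))).
  exact: (e (inl (inr q))).
case: c c' e => [p|h] [p'|h'] e.
- congr inl; apply/funext => i; have := e (inl (inl (inl (i, p' i)))).
  by rewrite /= eqxx => /eqP.
- by have := e (inr false).
- by have := e (inr false).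
- congr inr; apply/funext => s; apply/funext => j.
  exact: (e (inl (inl (inr (s, j))))).
Qed.

Lemma code_point_neq0 c r : code_point c r <> (fun=> false).
Proof.
move=> /(congr1 (fun f => f (pickle (inr true : probe)))).
by rewrite code_pointE.
Qed.

(** The zero branch is always included: it makes the set nonempty, and any two such sets share a
    branch. *)
Definition code_branches (x : code -> set R) : set (nat -> bool) :=
  [set y | y = (fun=> false) \/ exists c r, x c r /\ y = code_point c r].

Lemma code_branches_inj : injective code_branches.
Proof.
move=> x x' xx'; apply/funext => c; apply/funext => r; apply/propext.
have xP z : z c r <-> code_branches z (code_point c r).
  split=> [zcr|[/code_point_neq0//|[c' [r' [zcr /code_point_inj[-> ->]]]]]] //.
  by right; exists c, r.
by rewrite xP xx' -xP.
Qed.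

Definition coded_algebra x : subalgebra := branch_algebra R (code_branches x).

Lemma coded_algebra_inj : injective coded_algebra.
Proof.
move=> x x' e; apply: code_branches_inj.
by apply: (@branch_algebra_inj R _ _ (fun=> false)) e; left.
Qed.

End codes.

(* Koenig: if each [F1 c] missed some value at the coordinate [c], the diagonal
   function taking these values would lie in no [F1 c] and no [F2 c]. *)
Lemma diagonal_surjective (C1 C2 T : Type) (t1 t2 : T)
  (F1 : C1 -> set (C1 + C2 -> T)) (F2 : C2 -> set (C1 + C2 -> T)) :
  t1 <> t2 ->
  (forall x, (exists c, F1 c x) \/ (exists c, F2 c x)) ->
  (forall c x y, F2 c x -> F2 c y -> x = y) ->
  exists c, forall t, exists2 x, F1 c x & x (inl c) = t.
Proof.
move=> t12 cover F2_subsing; apply: contrapT => no.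
have /choice[d1 d1P] : forall c, exists t, forall x, F1 c x -> x (inl c) <> t.
  move=> c; apply: contrapT => /forallNP not; apply: no; exists c => t.
  apply: contrapT => nox; apply: (not t) => x Fx xt; apply: nox.
  by exists x.
(* [F2 c] has at most one element, so [t1] or [t2] differs from its value at [inr c]. *)
have /choice[d2 d2P] : forall c, exists t, forall x, F2 c x -> x (inr c) <> t.
  move=> c; have [[x Fx]|nF] := pselect (exists x, F2 c x); last first.
    by exists t1 => x Fx; case: nF; exists x.
  have [xt1|xt1] := pselect (x (inr c) = t1).
    by exists t2 => y /(F2_subsing _ _ _ Fx) <-; rewrite xt1.
  by exists t1 => y /(F2_subsing _ _ _ Fx) <-.
pose d c := match c with inl c1 => d1 c1 | inr c2 => d2 c2 end.
by have [[c /d1P]|[c /d2P]] := cover d.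
Qed.

Lemma injective_image (T U : Type) (f : T -> U) :
  injective f -> injective (fun A : set T => f @` A).
Proof.
move=> f_inj A B AB; apply/funext => a.
by rewrite -(image_inj (A := A) f_inj) AB image_inj.
Qed.

Lemma card_le_injective (T U : Type) (A : set T) (B : set U) (f : T -> U) :
  (forall x, A x -> B (f x)) -> {in A &, injective f} -> A #<= B.
Proof.
move=> AB f_inj; rewrite -(card_le_eql (inj_card_eq f_inj)).
by apply: subset_card_le => _ [x Ax <-]; exact: AB.
Qed.

(** Sets of integers embed in [R] by ternary expansions, hence algebras embed in [set R]. *)
Lemma card_subalgebra_le (R : realType) (H : set subalgebra) :
  H #<= [set: set R].
Proof.
pose iota (X : set nat) : R := ternary R (char_fun X).
have iota_inj : injective iota by move=> X Y /ternary_inj/char_fun_inj.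
apply: (@card_le_injective _ _ _ _ (fun A => iota @` subalgebra_set A)) => //.
by move=> A B _ _ /(injective_image iota_inj)/subalgebra_set_inj.
Qed.

Theorem theoremB (R : realType) :
  exists H : set subalgebra,
    [/\ H #= [set: set R],
        forall A B : subalgebra, H A -> H B -> A <> B ->
          ~ boolean_isomorphic (subalgebra_type A) (subalgebra_type B),
        forall A : subalgebra, H A -> ~ analytic (char_fun @` A),
        forall A : subalgebra, H A -> nikodym R (subalgebra_type A) &
        forall A : subalgebra, H A -> ~ grothendieck R (subalgebra_type A)].
Proof.
pose alg := @coded_algebra R.
pose good x := ~ analytic (char_fun @` subalgebra_set (alg x)).
pose iso x y :=
  boolean_isomorphic (subalgebra_type (alg x)) (subalgebra_type (alg y)).
(* A choice function on sets of families, with a dummy value at the empty set. As [rep x] depends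
   only on [cls x], isomorphic algebras get the same representative. *)
have /choice[sel selP] : forall P : set (code -> set R),
    exists y, (exists x, P x) -> P y.
  move=> P; have [[x Px]|nP] := pselect (exists x, P x); first by exists x.
  by exists (fun=> set0).
pose cls x : set (code -> set R) := [set y | good y /\ iso x y].
pose rep x := sel (cls x).
have repP x : good x -> good (rep x) /\ iso x (rep x).
  move=> gx; apply: (selP (cls x)); exists x; split => //.
  exact: boolean_isomorphic_refl.
have rep_eq x y : iso x y -> rep x = rep y.
  move=> xy; congr (sel _); apply/seteqP; split => z [gz xz]; split => //.
    exact: boolean_isomorphic_trans (boolean_isomorphic_sym xy) xz.
  exact: boolean_isomorphic_trans xy xz.
pose H : set subalgebra := [set A | exists2 x, good x & A = alg (rep x)].
have alg1 x k : subalgebra_set (alg x) [set k] by exact: branch_algebra1.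
exists H; split.
- rewrite card_eq_le card_subalgebra_le /=.
  (* By [isomorphic_image] each good family lies in some [F1 p]. The others are analytic and lie in
     some [F2 h], which has at most one element because [h] determines the continuous map. *)
  pose F1 (p : nat -> nat) : set (code -> set R) := [set x | good x /\
    subalgebra_set (alg x) = (fun X => p @` X) @` subalgebra_set (alg (rep x))].
  pose F2 (h : seq nat -> nat -> bool) : set (code -> set R) := [set x |
    exists f : baire_space -> cantor_space, [/\ continuous f,
      range f = char_fun @` subalgebra_set (alg x) & f \o baire_point = h]].
  have [|x|h x y|p pP] := @diagonal_surjective _ _ (set R) set0 setT F1 F2.
  + by move=> /(congr1 (fun X => X 0)) e; have : [set: R] 0 by []; rewrite -e.
  + have [gx|/contrapT bx] := pselect (good x); [left|right].
      have [_ xr] := repP x gx.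
      have [p] := isomorphic_image (alg1 _) (alg1 _) (boolean_isomorphic_sym xr).
      by exists p.
    (* The empty case of [analytic] is excluded because every algebra contains [set0]. *)
    case: bx => [e0|[f cf fE]]; last by exists (f \o baire_point), f.
    have : (char_fun @` subalgebra_set (alg x)) (char_fun set0).
      by exists set0 => //; exact: subalgebra0.
    by rewrite e0.
  + move=> [f [cf fE fh]] [g [cg gE gh]].
    apply/(@coded_algebra_inj R)/subalgebra_set_inj/(injective_image char_fun_inj).
    by rewrite -fE -gE (continuous_baire_ext cf cg)// fh.
  + have /choice[s sP] : forall t, exists x, F1 p x /\ x (inl p) = t.
      by move=> t; have [x] := pP t; exists x.
    (* The image under [p] recovers the algebra of [s t] from that of its representative, hence
       [s t], and then [t] as its value at [inl p]. *)
    apply: (@card_le_injective _ _ _ _ (fun t => alg (rep (s t)))).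
      by move=> t _; exists (s t) => //; have [[]] := sP t.
    move=> t u _ _ tu; have [[_ st] <-] := sP t; have [[_ su] <-] := sP u.
    suff -> : s t = s u by [].
    apply/(@coded_algebra_inj R)/subalgebra_set_inj.
    by rewrite -/alg st su tu.
- move=> _ _ [x gx ->] [y gy ->] xy xyI; apply: xy.
  have [_ xr] := repP x gx; have [_ yr] := repP y gy.
  congr alg; apply: rep_eq; apply: boolean_isomorphic_trans xr _.
  exact: boolean_isomorphic_trans xyI (boolean_isomorphic_sym yr).
- by move=> _ [x gx ->]; have [] := repP x gx.
- by move=> _ [x gx ->]; exact: nikodym_branch_algebra.
- move=> _ [x gx ->]; apply: (@not_grothendieck_branch_algebra R _ (fun=> false)).
  by left.
Qed.
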